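(* Let $\nu>-1/2$, $0\le\alpha<1$ and $0\le\lambda<1$, and let $\Phi(z)=z(2-S_\nu(z))$ for $z\in\mathbb{D}$. Then: (i) $\Phi\in\mathcal{T}^*_\lambda(\alpha)$ if and only if $$\lambda S_\nu''(1)+(1-\lambda\alpha+2\lambda)S_\nu'(1)+(1-\alpha)S_\nu(1)\le 2(1-\alpha);$$ (ii) $\Phi\in\mathcal{L}^*_\lambda(\alpha)$ if and only if $$\lambda S_\nu'''(1)+(5\lambda+1-\lambda\alpha)S_\nu''(1)+(4\lambda-2\lambda\alpha-\alpha+3)S_\nu'(1)+(1-\alpha)S_\nu(1)\le 2(1-\alpha).$$
   Context: Let $\mathbb{D}=\{z\in\mathbb{C}:|z|<1\}$. $\mathcal{A}$ denotes the class of functions $f$ analytic and univalent (injective) in $\mathbb{D}$, normalized by $f(0)=0$, $f'(0)=1$. $\mathcal{J}$ denotes the class of functions analytic in $\mathbb{D}$ of the form $f(z)=z-\sum_{n=2}^\infty b_nz^n$ with all $b_n>0$. For $\nu>-1$ the Bessel-Struve kernel function is the entire function $$S_\nu(z)=\sum_{n\ge 0}\frac{\Gamma(\nu+1)\,\Gamma\left(\frac{n+1}{2}\right)}{\sqrt{\pi}\,n!\,\Gamma\left(\frac n2+\nu+1\right)}z^n .$$ For $0\le\alpha<1$ and $0\le\lambda<1$, $$\mathcal{T}_\lambda(\alpha)=\left\{f\in\mathcal{A}:\ \operatorname{Re}\left(\frac{zf'(z)+\lambda z^2f''(z)}{(1-\lambda)f(z)+\lambda zf'(z)}\right)>\alpha\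 \text{ for all } z\in\mathbb{D}\right\},$$ $$\mathcal{L}_\lambda(\alpha)=\left\{f\in\mathcal{A}:\ \operatorname{Re}\left(\frac{\lambda z^3f'''(z)+(1+2\lambda)z^2f''(z)+zf'(z)}{zf'(z)+\lambda z^2f''(z)}\right)>\alpha\ \text{ for all } z\in\mathbb{D}\right\},$$ where the quotients are understood to have the value $1$ at $z=0$ (removable singularity) and membership requires that the denominators do not vanish for $z\in\mathbb{D}\setminus\{0\}$ apart from removable singularities. Set $\mathcal{T}^*_\lambda(\alpha)=\mathcal{T}_\lambda(\alpha)\cap\mathcal{J}$ and $\mathcal{L}^*_\lambda(\alpha)=\mathcal{L}_\lambda(\alpha)\cap\mathcal{J}$. *)

(* Defs.v *)
From HB Require Import structures.
From mathcomp Require Import all_boot all_order all_algebra.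
From mathcomp Require Import complex.
From mathcomp Require Import all_classical all_reals all_analysis.

Set Implicit Arguments.
Unset Strict Implicit.
Unset Printing Implicit Defensive.

Import Order.TTheory GRing.Theory Num.Theory numFieldNormedType.Exports.

Local Open Scope classical_set_scope.
Local Open Scope complex_scope.
Local Open Scope ring_scope.

(* The regular module [R[i]^o] is the form of the complex numbers on which the
   normed-module structure over [R[i]] is found, so that [derivable f z 1] and
   [derive1n n f z] are complex differentiability and the n-th complex
   derivative. *)
Notation CC R := ((R[i])^o).

Definition unit_disc (R : realType) : set (CC R) := [set z | `|z| < 1].

(* [U] is meant to be open. *)
Definition analytic_on (R : realType) (U : set (CC R)) (f : CC R -> CC R) : Prop :=
  forall z, U z -> derivable f z 1.

(* Functions on the disc are represented by total functions; only their values
   on the disc matter, since the disc is open. *)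
Definition classA (R : realType) (f : CC R -> CC R) : Prop :=
  [/\ analytic_on (@unit_disc R) f,
      set_inj (@unit_disc R) f,
      f 0 = 0 &
      derive1n 1 f 0 = 1].

Definition classJ (R : realType) (f : CC R -> CC R) : Prop :=
  analytic_on (@unit_disc R) f /\
  exists b : nat -> R,
    (forall n : nat, (2 <= n)%N -> 0 < b n) /\
    (forall z : CC R, unit_disc z ->
       (z - \sum_(2 <= k < n) (b k)%:C * z ^+ k : CC R) @[n --> \oo] --> f z).

(* [q] is the quotient [num / den] on the unit disc, with its removable
   singularities removed and with the value 1 at 0. The existence of such an
   analytic [q] says that every zero of [den] in the disc is a removable
   singularity of [num / den]. In the two uses below, for [f] in [classA] the
   denominator is analytic with a simple zero at 0, so its zeros are isolated
   and [q] is unique on the disc. *)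
Definition regular_quotient (R : realType) (num den q : CC R -> CC R) : Prop :=
  [/\ analytic_on (@unit_disc R) q,
      q 0 = 1 &
      forall z, unit_disc z -> den z != 0 -> q z = num z / den z].

Definition classT (R : realType) (lambda alpha : R) (f : CC R -> CC R) : Prop :=
  classA f /\
  exists q : CC R -> CC R,
    regular_quotient
      (fun z => z * derive1n 1 f z + lambda%:C * z ^+ 2 * derive1n 2 f z)
      (fun z => (1 - lambda)%:C * f z + lambda%:C * z * derive1n 1 f z) q /\
    (forall z, unit_disc z -> alpha < complex.Re (q z)).

Definition classL (R : realType) (lambda alpha : R) (f : CC R -> CC R) : Prop :=
  classA f /\
  exists q : CC R -> CC R,
    regular_quotient
      (fun z => lambda%:C * z ^+ 3 * derive1n 3 f z
                + (1 + 2 * lambda)%:C * z ^+ 2 * derive1n 2 f z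
                + z * derive1n 1 f z)
      (fun z => z * derive1n 1 f z + lambda%:C * z ^+ 2 * derive1n 2 f z) q /\
    (forall z, unit_disc z -> alpha < complex.Re (q z)).

Definition classT_star (R : realType) (lambda alpha : R) (f : CC R -> CC R) : Prop :=
  classT lambda alpha f /\ classJ f.

Definition classL_star (R : realType) (lambda alpha : R) (f : CC R -> CC R) : Prop :=
  classL lambda alpha f /\ classJ f.

(* Euler's integral; it is the Gamma function for [0 < a], the only arguments
   used below. *)
Definition Gamma (R : realType) (a : R) : R :=
  \int[lebesgue_measure]_(t in `]0%R, +oo[) (t `^ (a - 1) * expR (- t)).

Definition bessel_struve_coef (R : realType) (nu : R) (n : nat) : R :=
  Gamma (nu + 1) * Gamma ((n%:R + 1) / 2)
  / (Num.sqrt pi * n`!%:R * Gamma (n%:R / 2 + nu + 1)).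

Definition bessel_struve (R : realType) (nu : R) (z : CC R) : CC R :=
  limn (series (fun n => (bessel_struve_coef nu n)%:C * z ^+ n : CC R)).

Definition bessel_struve_Phi (R : realType) (nu : R) (z : CC R) : CC R :=
  z * (2 - bessel_struve nu z).

(* Main.v *)
Require Import Defs.
From HB Require Import structures.
From mathcomp Require Import all_boot all_order all_algebra.
From mathcomp Require Import complex.
From mathcomp Require Import all_classical all_reals all_analysis.
From mathcomp Require Import measurable_realfun zify ring lra.
Import Order.TTheory GRing.Theory Num.Theory numFieldNormedType.Exports.
Local Open Scope classical_set_scope.
Local Open Scope complex_scope.
Local Open Scope ring_scope.

(** A power series with nonnegative coefficients attains on the positive axis
    its maximum modulus on circles.  Here [Phi z = z * (2 - S z)], and after
    cancelling the common factor [z] each of the two quotients becomes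
    [1 - Q / (2 - P)], where [P] and [Q] are nonnegative combinations of the
    [z^k S^(k)].  If [Q 1 + (1 - alpha) P 1 <= 2 (1 - alpha)], then for
    [|z| = r < 1] one gets [|Q z| <= Q r < (1 - alpha) (2 - P r)
    <= (1 - alpha) |2 - P z|], so the quotient has real part above [alpha].
    Otherwise [2 (1 - alpha) - Q r - (1 - alpha) P r] vanishes at some
    [r] in ]0, 1[, and there the quotient equals [alpha].  Both inequalities
    imply [S 1 + S' 1 <= 2], from which [Phi] is injective on the disc.

    On the Gamma function only [Gamma (1 / 2) = sqrt pi], a uniform positive
    lower bound on [[1/2, +oo[], and [Gamma a <= sqrt pi + Gamma (a + d)] are
    needed; they bound the n-th coefficient of [S] by [C / n!], a bound that
    is stable under termwise differentiation. *)

(** * The Gamma integral *)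

Definition gamma_density {R : realType} (a t : R) : R :=
  t `^ (a - 1) * expR (- t).

Section Gamma_facts.
Context {R : realType}.
Implicit Types a t : R.
Let mu := @lebesgue_measure R.
Local Notation D := (`]0%R, +oo[%classic : set R).

Lemma gamma_density_ge0 a t : 0 <= gamma_density a t.
Proof. by rewrite mulr_ge0 ?powR_ge0 ?expR_ge0. Qed.

Lemma measurable_gamma_density a : measurable_fun [set: R] (gamma_density a).
Proof.
apply: measurable_funM; first exact: measurable_powR.
by apply: measurableT_comp => //; exact: measurable_expR.
Qed.

(** This form is the integrand of the substitution [x = Num.sqrt t] in the Gaussian integral, with
    [(2 * Num.sqrt t)^-1] the derivative of the square root. *)
Lemma gamma_density_half t : 0 < t ->
  gamma_density (1 / 2) t = 2 * (gauss_fun (Num.sqrt t) * (2 * Num.sqrt t)^-1).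
Proof.
move=> t0; rewrite /gamma_density /gauss_fun sqr_sqrtr ?ltW//.
have -> : 1 / 2 - 1 = - 2^-1 :> R by field.
rewrite powRN powR12_sqrt ?ltW//.
by field; rewrite gt_eqF ?sqrtr_gt0.
Qed.

(* The derivative of [Num.sqrt] blows up at 0, so the substitution [t = x ^+ 2]
   is made on [[a, +oo[] with [0 < a], and [a] tends to 0 afterwards. *)
Lemma integral_gamma_density_half_tail a : 0 < a ->
  (\int[mu]_(t in `[a, +oo[) (gauss_fun (Num.sqrt t) * (2 * Num.sqrt t)^-1)%:E
   = \int[mu]_(t in `[Num.sqrt a, +oo[) (gauss_fun t)%:E)%E.
Proof.
move=> a0.
have dE t : 0 < t -> Num.sqrt^`()%classic t = (2 * Num.sqrt t)^-1.
  by move=> t0; rewrite derive1E derive_sqrt.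
have cdS t : 0 < t -> ((2 * Num.sqrt s)^-1 : R) @[s --> t] --> (2 * Num.sqrt t)^-1.
  move=> t0; apply: cvgV; first by rewrite mulf_neq0// gt_eqF ?sqrtr_gt0.
  by apply: cvgMr; exact: sqrt_continuous.
have sy : Num.sqrt x @[x --> +oo] --> (+oo : set_system R).
  apply/cvgryPge => A; near=> x.
  have Ax : A ^+ 2 <= x by near: x; apply: nbhs_pinfty_ge; exact: num_real.
  have [A0|/ltW A0] := leP 0 A; last by rewrite (le_trans A0)// sqrtr_ge0.
  by rewrite -(ger0_norm A0) -sqrtr_sqr ler_wsqrtr.
have cd t : 0 < t ->
    Num.sqrt^`()%classic s @[s --> t] --> (Num.sqrt^`()%classic t : R).
  move=> t0; have -> := dE _ t0.
  apply: cvg_trans (cdS t t0); apply: near_eq_cvg; near=> s.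
  by rewrite dE//; near: s; exact: lt_nbhsr.
rewrite (@increasing_ge0_integration_by_substitutiony _ Num.sqrt gauss_fun a).
- apply: eq_integral => t; rewrite inE/= in_itv/= andbT => at0.
  by rewrite fctE/= dE// (lt_le_trans a0).
- move=> x y; rewrite !in_itv/= !andbT => ax ay xy.
  by rewrite ltr_sqrt// (lt_le_trans a0).
- by move=> x; rewrite in_itv/= andbT => ax; apply: cd; exact: lt_trans ax.
- apply/cvg_ex; exists (Num.sqrt^`()%classic a).
  by apply: cvg_at_right_filter; exact: cd.
- apply/cvg_ex; exists 0.
  apply: (@cvg_trans _ ((2 * Num.sqrt x)^-1 @[x --> +oo])).
    apply: near_eq_cvg; near=> x.
    have x0 : 0 < x by near: x; exact: nbhs_pinfty_gt.
    by rewrite dE.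
  apply/(gtr0_cvgV0 (f := fun x : R => 2 * Num.sqrt x)); last exact: gt0_cvgMry.
  near=> x; have x0 : 0 < x by near: x; exact: nbhs_pinfty_gt.
  by rewrite mulr_gt0// sqrtr_gt0.
- split; last by apply: cvg_at_right_filter; exact: sqrt_continuous.
  move=> x; rewrite in_itv/= andbT => ax.
  by have [] := is_derive1_sqrt (lt_trans a0 ax).
- exact: sy.
- by apply: continuous_subspaceT => x; exact: continuous_gauss_fun.
- by move=> x _; exact: gauss_fun_ge0.
Unshelve. all: by end_near. Qed.



(** Monotone convergence along the increasing sets [[u n, +oo[], whose union is []0, +oo[] because
    [u] decreases to 0. *)
Lemma cvg_integral_itvcy (f : R -> R) (u : R^nat) :
  (forall t, 0 <= f t) -> measurable_fun [set: R] f ->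
  (forall n, 0 < u n) -> nonincreasing_seq u -> u n @[n --> \oo] --> 0 ->
  (\int[mu]_(t in `[u n, +oo[) (f t)%:E @[n --> \oo]
   --> \int[mu]_(t in D) (f t)%:E)%E.
Proof.
move=> f0 mf u0 du u_to0.
have -> : D = \bigcup_n [set` `[u n, +oo[].
  apply/seteqP; split => [t|t [n _]] /=; rewrite !in_itv/= !andbT; last first.
    exact: lt_le_trans.
  move=> t0; have [n unt] : exists n, u n <= t.
    have /cvgrPdist_le/(_ t t0) [n _ /(_ n (leqnn n)) /=] := u_to0.
    by rewrite sub0r normrN gtr0_norm//; exists n.
  by exists n => //=; rewrite in_itv/= andbT.
apply: ge0_nondecreasing_set_cvg_integral => //.
- move=> m n mn; apply/subsetPset => t /=; rewrite !in_itv/= !andbT.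
  by apply: le_trans; exact: du.
- by move=> n; apply: measurable_funTS; exact/measurable_EFinP.
- by move=> n t _; rewrite lee_fin.
Qed.

(** The substitution identifies the tails from [harmonic n] and from [Num.sqrt (harmonic n)]. Both
    cut-offs decrease to 0, so the full integrals agree, and the Gaussian integral over the
    half-line supplies the value. *)
Lemma integral_gamma_density_half :
  (\int[mu]_(t in D) (gamma_density (1 / 2) t)%:E = (Num.sqrt pi)%:E)%E.
Proof.
(* The factor [2^-1] makes [h] exactly the substituted Gaussian integrand. *)
pose h := fun t : R => 2^-1 * gamma_density (1 / 2) t.
have h0 t : 0 <= h t by rewrite mulr_ge0 ?invr_ge0 ?gamma_density_ge0.
have mh : measurable_fun [set: R] h.
  by apply: measurable_funM => //; exact: measurable_gamma_density.
have hE t : 0 < t -> h t = gauss_fun (Num.sqrt t) * (2 * Num.sqrt t)^-1.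
  by move=> t0; rewrite /h gamma_density_half// mulKf.
have harm : nonincreasing_seq (@harmonic R).
  by move=> m n mn; rewrite lef_pV2 ?posrE// ler_nat ltnS.
have c1 := @cvg_integral_itvcy h _ h0 mh harmonic_gt0 harm cvg_harmonic.
have c2 : (\int[mu]_(t in `[Num.sqrt (harmonic n), +oo[) (gauss_fun t)%:E @[n --> \oo]
   --> \int[mu]_(t in D) (gauss_fun t)%:E)%E.
  apply: cvg_integral_itvcy.
  - exact: gauss_fun_ge0.
  - exact: measurable_gauss_fun.
  - by move=> n; rewrite sqrtr_gt0 harmonic_gt0.
  - by move=> m n mn; rewrite ler_wsqrtr// harm.
  - rewrite -[X in _ --> X](@sqrtr0 R).
    by apply: continuous_cvg; [exact: sqrt_continuous|exact: cvg_harmonic].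
have hD : (\int[mu]_(t in D) (h t)%:E = \int[mu]_(t in D) (gauss_fun t)%:E)%E.
  rewrite -(cvg_lim (@ereal_hausdorff R) c1); apply: cvg_lim => //.
  apply: cvg_trans c2; apply: near_eq_cvg; near=> n.
  rewrite -integral_gamma_density_half_tail ?harmonic_gt0//.
  apply: eq_integral => t; rewrite inE/= in_itv/= andbT => nt.
  by rewrite hE// (lt_le_trans _ nt)// harmonic_gt0.
under eq_integral => t _.
  have -> : (gamma_density (1 / 2) t)%:E = (2%:E * (h t)%:E)%E.
    by rewrite -EFinM /h mulVKf.
  over.
rewrite ge0_integralZl//; first last.
- by move=> t _; rewrite lee_fin.
- by apply: measurable_funTS; exact/measurable_EFinP.
rewrite hD integral_itv_obnd_cbnd; last first.
  by apply: measurable_funTS; apply/measurable_EFinP; exact: measurable_gauss_fun.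
by rewrite integral0y_gauss -EFinM mulrC divfK.
Unshelve. all: by end_near. Qed.

End Gamma_facts.

(** * Integrability of the Gamma density and bounds on Gamma *)

Section Gamma_bounds.
Context {R : realType}.
Implicit Types a t : R.
Let mu := @lebesgue_measure R.
Local Notation D := (`]0%R, +oo[%classic : set (measurableTypeR R)).

Lemma integrable_EFinZl (E : set (measurableTypeR R)) (k : R) (f : R -> R) :
  measurable E ->
  mu.-integrable E (EFin \o f) -> mu.-integrable E (EFin \o (fun t => k * f t)).
Proof.
by move=> mE fi; exact: (integrableZl mE k fi).
Qed.

Lemma integrable_gamma_density_half :
  mu.-integrable D (EFin \o gamma_density (1 / 2)).
Proof.
apply/integrableP; split.
  by apply: measurable_funTS; apply/measurable_EFinP; exact: measurable_gamma_density.
under eq_integral do rewrite /= ger0_norm ?gamma_density_ge0//.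
by rewrite integral_gamma_density_half ltry.
Qed.

Lemma integrable_expR_half : mu.-integrable D (EFin \o (fun t => expR (- t / 2))).
Proof.
(* The exponential law of rate 1/2 has density [expR (- t / 2) / 2] on the positive axis. *)
have i1 : mu.-integrable D (EFin \o (fun t => 2 * exponential_pdf (2^-1 : R) t)).
  apply: (@integrableS _ _ _ _ setT) => //.
  apply: integrable_EFinZl => //; apply: integrable_exponential_pdf.
  by rewrite invr_gt0.
apply: eq_integrable i1 => // t; rewrite inE/= in_itv/= andbT => t0.
by rewrite exponential_pdfE ?ltW// mulVKf// mulrC mulrN mulNr.
Qed.

(** For [t <= 1] the exponent [a - 1 >= - 1/2] gives the first term. For [t >= 1] the power is at
    most [t ^+ n], which is absorbed by half of the exponential decay. *)
Lemma gamma_density_dominated a : 1 / 2 <= a ->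
  exists K : R, 0 <= K /\ forall t, 0 < t ->
  gamma_density a t <= gamma_density (1 / 2) t + K * expR (- t / 2).
Proof.
move=> a12.
have [n n0 an] : exists2 n, (0 < n)%N & a - 1 <= n%:R.
  exists (Num.truncn a).+1 => //.
  by rewrite lerBlDr (le_trans (ltW (truncnS_gt a)))// lerDl.
exists (2 ^+ n * n`!%:R); split=> [|t t0]; first by rewrite mulr_ge0// exprn_ge0.
have [t1|/ltW t1] := leP t 1.
  rewrite ler_wpDr ?mulr_ge0 ?expR_ge0 ?exprn_ge0//.
  by rewrite ler_wpM2r ?expR_ge0// ger_powR ?t0// lerD2r.
rewrite ler_wpDl ?gamma_density_ge0//.
have tn : t ^+ n <= 2 ^+ n * n`!%:R * expR (t / 2).
  (* One term of the exponential series at [t / 2] gives the constant [2 ^+ n * n!]. The bound is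
     stated for a successor exponent, hence the choice of a positive [n]. *)
  have /(@expR_ge1Dxn R _ n.-1) : 0 <= t / 2 by rewrite divr_ge0// ltW.
  rewrite prednK// => /(le_trans _) h.
  have {h} : (t / 2) ^+ n / n`!%:R <= expR (t / 2) by apply: h; rewrite lerDr.
  rewrite ler_pdivrMr ?ltr0n ?fact_gt0// expr_div_n ler_pdivrMr ?exprn_gt0//.
  by rewrite -[2 ^+ n * _ * _]mulrA [2 ^+ n * _]mulrC [n`!%:R * _]mulrC.
rewrite /gamma_density (le_trans (ler_wpM2r (expR_ge0 _) (ler_powR t1 an)))//.
rewrite (powR_mulrn _ (ltW t0)); apply: le_trans (ler_wpM2r (expR_ge0 _) tn) _.
rewrite -[_ * _ * expR (- t)]mulrA -expRD.
by rewrite ler_pM2l ?mulr_gt0 ?exprn_gt0 ?ltr0n ?fact_gt0// ler_expR; lra.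
Qed.

Lemma integrable_gamma_density a : 1 / 2 <= a ->
  mu.-integrable D (EFin \o gamma_density a).
Proof.
move=> /gamma_density_dominated[K [K0 dom]].
have mD : measurable D by [].
have := integrableD mD integrable_gamma_density_half
  (integrable_EFinZl _ K _ mD integrable_expR_half).
apply: le_integrable => //.
  by apply: measurable_funTS; apply/measurable_EFinP; exact: measurable_gamma_density.
move=> t /=; rewrite in_itv/= andbT => t0.
rewrite lee_fin ger0_norm ?gamma_density_ge0// ger0_norm ?dom//.
by rewrite addr_ge0 ?gamma_density_ge0// mulr_ge0// expR_ge0.
Qed.

Lemma Gamma_half : Gamma (1 / 2 : R) = Num.sqrt pi.
Proof. by rewrite /Gamma /Rintegral integral_gamma_density_half. Qed.

(** On [[1, 2]] the density is at least [t^-1 * expR (- 2) >= expR (- 2) / 2], as [a - 1 >= -1], and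
    the interval has length 1. *)
Lemma Gamma_ge a : 1 / 2 <= a -> expR (- 2) / 2 <= Gamma a.
Proof.
move=> a12.
have i1 : mu.-integrable D (EFin \o (\1_(`[1%R, 2%R]) : R -> R)).
  exact: (integrableS measurableT _ _ (integrable_indic_itv 1 2 true false)).
have i2 : mu.-integrable D (EFin \o (fun t => expR (- 2) / 2 * (\1_(`[1%R, 2%R]) t : R))).
  exact: integrable_EFinZl.
have : \int[mu]_(t in D) (expR (- 2) / 2 * (\1_(`[1%R, 2%R]) t : R)) <= Gamma a.
  apply: le_Rintegral => //; first exact: integrable_gamma_density.
  move=> t /=; rewrite in_itv/= andbT => t0.
  rewrite indicE; case: (boolP (t \in _)) => [|_]; last first.
    by rewrite mulr0 gamma_density_ge0.
  rewrite inE/= in_itv/= => /andP[t1 t2]; rewrite mulr1 mulrC.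
  apply: ler_pM; rewrite ?expR_ge0 ?invr_ge0//; last by rewrite ler_expR lerN2.
  apply: (@le_trans _ _ (t `^ (- 1))); last by apply: ler_powR => //; lra.
  by rewrite (powR_inv1 (ltW t0)) lef_pV2 ?posrE.
apply: le_trans; rewrite RintegralZl// /Rintegral integral_indic//=.
rewrite setIidl; last first.
  by move=> t /=; rewrite !in_itv/= andbT => /andP[+ _]; apply: lt_le_trans.
rewrite lebesgue_measure_itv/= lte_fin ltr1n/=.
by rewrite (_ : 2 - 1 = 1 :> R) ?mulr1//; lra.
Qed.

Lemma Gamma_gt0 a : 1 / 2 <= a -> 0 < Gamma a.
Proof. by move/Gamma_ge; apply: lt_le_trans; rewrite divr_gt0 ?expR_gt0. Qed.

(** Pointwise, [t] to the power [a - 1] is at most its power [- 1/2] when [t <= 1], and at most its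
    power [a + d - 1] when [t >= 1]. The two majorants integrate to [Gamma (1 / 2)] and
    [Gamma (a + d)]. *)
Lemma Gamma_le_shift a d : 1 / 2 <= a -> 0 <= d ->
  Gamma a <= Num.sqrt pi + Gamma (a + d).
Proof.
move=> a12 d0.
have ad12 : 1 / 2 <= a + d by rewrite (le_trans a12)// lerDl.
rewrite -Gamma_half -RintegralD//; try exact: integrable_gamma_density.
apply: le_Rintegral => //.
- exact: integrable_gamma_density.
- exact: (integrableD _ integrable_gamma_density_half (integrable_gamma_density _ ad12)).
move=> t /=; rewrite in_itv/= andbT => t0; rewrite -mulrDl ler_wpM2r ?expR_ge0//.
have [t1|/ltW t1] := leP t 1.
  by rewrite ler_wpDr ?powR_ge0// ger_powR ?t0// lerD2r.
by rewrite ler_wpDl ?powR_ge0// ler_powR// lerD2r lerDl.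
Qed.

End Gamma_bounds.

(** * Power series *)

Section complex_limits.
Context {R : realType}.
Implicit Types (z w : R[i]) (u : nat -> CC R).

(** The norm of [R[i]] takes its values in [R[i]]; this form lets estimates be moved to [R] by
    [lecR]. *)
Lemma normcE_real z : `|z| = (complex.Re `|z|)%:C.
Proof. by rewrite RRe_real// ger0_real. Qed.

Lemma complex_gt0E z : 0 < z -> exists2 e : R, 0 < e & z = e%:C.
Proof.
move=> z0; exists (complex.Re z); last by rewrite RRe_real// gtr0_real.
by move: z0; rewrite ltcE => /andP[].
Qed.

Lemma norm_le_ReIm z : `|z| <= (`|complex.Re z| + `|complex.Im z|)%:C.
Proof.
rewrite {1}(complexE z) (le_trans (ler_normD _ _))// rmorphD/= normrM.
by rewrite !normc_def/= !expr0n/= !addr0 expr1n add0r sqrtr1 mul1r !sqrtr_sqr.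
Qed.

Lemma le_ReIm_norm z (v : R) : `|z| <= v%:C ->
  `|complex.Re z| <= v /\ `|complex.Im z| <= v.
Proof.
move=> zv; split; rewrite -lecR; apply: le_trans zv; first exact: normc_ge_Re.
rewrite -[complex.Im z]opprK normrN -ReiNIm (le_trans (normc_ge_Re _))//.
by rewrite normrM (normc_def 'i%C)/= expr0n expr1n add0r sqrtr1 mulr1.
Qed.

Lemma cvg_complexP u (l : CC R) :
  (forall e : R, 0 < e -> \forall n \near \oo, `|l - u n| <= e%:C) <->
  u n @[n --> \oo] --> l.
Proof.
split => [h|h e e0]; last first.
  by move/cvgrPdist_le: h; apply; rewrite ltcR.
by apply/cvgrPdist_le => _ /complex_gt0E[e e0 ->]; exact: h.
Qed.

Lemma cvg_Re_Im u (x y : R) :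
  complex.Re (u n) @[n --> \oo] --> x -> complex.Im (u n) @[n --> \oo] --> y ->
  u n @[n --> \oo] --> (x +i* y : CC R).
Proof.
move=> ux uy; apply/cvg_complexP => e e0.
have e20 : 0 < e / 2 by rewrite divr_gt0.
move/cvgrPdist_le : ux => /(_ _ e20) ux; move/cvgrPdist_le : uy => /(_ _ e20) uy.
near=> n; apply: le_trans (norm_le_ReIm _) _; rewrite lecR.
rewrite (splitr e) !raddfB/= lerD//; first by near: n.
by near: n.
Unshelve. all: by end_near. Qed.

Lemma norm_lim_le u (l : CC R) (M : R) : u n @[n --> \oo] --> l ->
  (\forall n \near \oo, `|u n| <= M%:C) -> `|l| <= M%:C.
Proof.
move=> /cvg_complexP ul uM; rewrite normcE_real lecR.
apply/ler_addgt0Pr => e e0; rewrite -lecR -normcE_real.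
near \oo => n.
rewrite -(subrK (u n) l) (le_trans (ler_normD _ _))// addrC rmorphD/= lerD//.
  by near: n.
by near: n; exact: ul.
Unshelve. all: by end_near. Qed.

(** The real and imaginary parts are real series, each absolutely dominated by [v]. *)
Lemma is_cvg_series_dominated u (v : nat -> R) :
  (forall n, `|u n| <= (v n)%:C) -> cvgn (series v) -> cvgn (series u).
Proof.
move=> uv cv.
have main (f : nat -> R) : (forall n, `|f n| <= v n) -> cvgn (series f).
  move=> fv; apply: normed_cvg; apply: series_le_cvg cv => n //=.
  exact: le_trans (normr_ge0 _) (fv n).
have /cvg_ex[x xP] : cvgn (series (fun n => complex.Re (u n))).
  by apply: main => n; have [] := le_ReIm_norm _ _ (uv n).
have /cvg_ex[y yP] : cvgn (series (fun n => complex.Im (u n))).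
  by apply: main => n; have [] := le_ReIm_norm _ _ (uv n).
apply/cvg_ex; exists (x +i* y); apply: cvg_Re_Im.
  apply: cvg_trans xP; apply: near_eq_cvg; near=> n.
  by rewrite /series/= raddf_sum.
apply: cvg_trans yP; apply: near_eq_cvg; near=> n.
by rewrite /series/= raddf_sum.
Unshelve. all: by end_near. Qed.

End complex_limits.

Definition factorially_bounded {R : realType} (C : R) (a : nat -> R) :=
  forall n, 0 <= a n <= C / n`!%:R.

Definition real_pseries {R : realType} (a : nat -> R) (r : R) : R :=
  limn (pseries a r).

Definition complex_pseries {R : realType} (a : nat -> R) (z : CC R) : CC R :=
  limn (series (fun n => (a n)%:C * z ^+ n : CC R)).

(** * Real power series with factorially bounded coefficients *)

Section real_power_series.
Context {R : realType}.
Variables (C : R) (a : nat -> R).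
Hypothesis aC : factorially_bounded C a.
Implicit Types r s : R.

(** Since [(n + 1) / (n + 1)! = 1 / n!], the same constant [C] serves for all derivatives. *)
Lemma factorially_bounded_diffs : factorially_bounded C (pseries_diffs a).
Proof.
move=> n; rewrite /pseries_diffs; have /andP[a0 aC1] := aC n.+1.
rewrite mulr_ge0//=; apply: le_trans (ler_wpM2l _ aC1) _ => //.
by rewrite factS natrM invfM mulrCA mulVKf.
Qed.

Lemma is_cvg_real_pseries r : 0 <= r -> cvgn (pseries a r).
Proof.
move=> r0; apply: (@series_le_cvg _ _ (fun n => C * exp_coeff r n)) => [n|n|n|].
- by have /andP[a0 _] := aC n; rewrite mulr_ge0 ?exprn_ge0.
- have /andP[a0 aC1] := aC n.
  have C0 : 0 <= C.
    by move: (le_trans a0 aC1); rewrite pmulr_lge0// invr_gt0 ltr0n fact_gt0.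
  by rewrite mulr_ge0 ?exp_coeff_ge0.
- have /andP[_ aC1] := aC n.
  by rewrite /exp_coeff/= mulrA mulrAC ler_wpM2r ?exprn_ge0.
- exact: (is_cvg_seriesZ (k := C) (is_cvg_series_exp_coeff r)).
Qed.

Lemma pseries_le_real_pseries r n : 0 <= r -> pseries a r n <= real_pseries a r.
Proof.
move=> r0; apply: nondecreasing_cvgn_le; last exact: is_cvg_real_pseries.
apply: nondecreasing_series => k _ _.
by have /andP[a0 _] := aC k; rewrite mulr_ge0 ?exprn_ge0.
Qed.

Lemma real_pseries_ge0 r : 0 <= r -> 0 <= real_pseries a r.
Proof.
move=> r0; apply: le_trans (pseries_le_real_pseries r 0 r0).
by rewrite /pseries/= /series/= big_nil.
Qed.

Lemma real_pseries0 : real_pseries a 0 = a 0%N.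
Proof.
apply: cvg_lim => //; rewrite -cvg_shiftS.
apply: cvg_near_cst; near=> n.
rewrite /pseries/= /series/= big_nat_recl// expr0 mulr1 big1 ?addr0// => i _.
by rewrite exprS mul0r mulr0.
Unshelve. all: by end_near. Qed.

(** The constant terms cancel, the linear terms give the left side, and the later terms are
    nondecreasing. It yields monotonicity, and strict monotonicity when [a 1 > 0]. *)
Lemma real_pseries_increment r s : 0 <= r <= s ->
  a 1%N * (s - r) <= real_pseries a s - real_pseries a r.
Proof.
move=> /andP[r0 rs]; rewrite lerBrDl; have s0 := le_trans r0 rs.
have cr := is_cvg_real_pseries r r0.
rewrite -(cvg_lim _ (cvgD cr (cvg_cst (a 1%N * (s - r)))))//.
apply: limr_le; first by apply: is_cvgD => //; exact: is_cvg_cst.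
near=> n; change (pseries a r n + a 1%N * (s - r) <= real_pseries a s).
apply: le_trans (pseries_le_real_pseries s n s0).
have n2 : (2 <= n)%N by near: n; exact: nbhs_infty_ge.
rewrite /pseries/= /series/= -(subnK n2) addn2.
rewrite !big_nat_recl//= !expr0 !expr1.
rewrite -!addrA lerD2l addrCA -mulrDr subrKC addrC lerD2l.
apply: ler_sum => i _.
have /andP[ai _] := aC i.+2.
by rewrite ler_wpM2l// lerXn2r// qualifE.
Unshelve. all: by end_near. Qed.

End real_power_series.

Section real_power_series_continuity.
Context {R : realType}.

Lemma continuous_real_pseries (C : R) a : factorially_bounded C a ->
  continuous (real_pseries a).
Proof.
move=> aC x; apply: differentiable_continuous; apply/derivable1_diffP.
(* Differentiability at [x] follows from convergence of the series and of its first two termwise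
   derivatives at a point beyond [|x|]. *)
have K0 : 0 <= `|x| + 1 by rewrite addr_ge0.
have := @pseries_snd_diffs R a (`|x| + 1) x.
have aC' := factorially_bounded_diffs _ _ aC.
have aC'' := factorially_bounded_diffs _ _ aC'.
move=> /(_ (is_cvg_real_pseries _ _ aC _ K0) (is_cvg_real_pseries _ _ aC' _ K0)).
move=> /(_ (is_cvg_real_pseries _ _ aC'' _ K0)).
by rewrite [X in _ < X]ger0_norm// ltrDl => /(_ ltr01) [].
Qed.

End real_power_series_continuity.

(** * First- and second-order estimates for differences of powers *)

Section power_differences.
Context {K : numDomainType}.
Implicit Types z w r : K.

Lemma norm_subX_le z w r n : `|z| <= r -> `|w| <= r ->
  `|w ^+ n - z ^+ n| <= `|w - z| * (n%:R * r ^+ n.-1).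
Proof.
move=> zr wr; have r0 : 0 <= r by exact: le_trans zr.
case: n => [|n]; first by rewrite !expr0 subrr normr0 mul0r mulr0.
rewrite subrXX normrM ler_wpM2l//= (le_trans (ler_norm_sum _ _ _))//.
rewrite -[n.+1 in leRHS]card_ord mulr_natl -sumr_const ler_sum// => i _.
rewrite normrM !normrX.
have -> : r ^+ n = r ^+ (n.+1.-1 - i) * r ^+ i by rewrite -exprD subnK// -ltnS.
by rewrite ler_pM ?exprn_ge0// lerXn2r// qualifE/=.
Qed.

Lemma norm_subX_taylor_le z w r n : `|z| <= r -> `|w| <= r ->
  `|w ^+ n - z ^+ n - (w - z) * (n%:R * z ^+ n.-1)|
    <= `|w - z| ^+ 2 * ((n * n.-1)%:R * r ^+ n.-2).
Proof.
move=> zr wr; have r0 : 0 <= r by exact: le_trans zr.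
elim: n => [|[|n] IH].
- by rewrite !expr0 !mul0r mulr0 !subrr normr0 mulr0.
- by rewrite !expr1 expr0 !mul1r mulr1 !subrr normr0 muln0 mul0r mulr0.
(* The remainder of degree [n + 2] is [w] times that of degree [n + 1] plus a multiple of
   [(w - z) ^+ 2]. The bound then follows from [(n + 1) n + (n + 1) <= (n + 2) (n + 1)]. *)
have -> : w ^+ n.+2 - z ^+ n.+2 - (w - z) * (n.+2%:R * z ^+ n.+1) =
   w * (w ^+ n.+1 - z ^+ n.+1 - (w - z) * (n.+1%:R * z ^+ n)) +
   (w - z) ^+ 2 * (n.+1%:R * z ^+ n).
  by rewrite !exprS -natr1; ring.
rewrite (le_trans (ler_normD _ _))//.
apply: (@le_trans _ _ (r * (`|w - z| ^+ 2 * ((n.+1 * n)%:R * r ^+ n.-1)) +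
   `|w - z| ^+ 2 * (n.+1%:R * r ^+ n))).
  apply: lerD; first by rewrite normrM ler_pM.
  rewrite normrM normrX ler_wpM2l ?exprn_ge0// normrM normr_nat ler_wpM2l//.
  by rewrite normrX lerXn2r// qualifE/=.
rewrite mulrCA -mulrDr ler_wpM2l ?exprn_ge0//= mulrCA.
(* For [n = 0] the truncated predecessor breaks the power identity, but the factor [n] vanishes. *)
have -> : (n.+1 * n)%:R * (r * r ^+ n.-1) = (n.+1 * n)%:R * r ^+ n.
  by case: n {IH} => [|n]; rewrite ?muln0 ?mul0r//= -exprS.
by rewrite -mulrDl ler_wpM2r ?exprn_ge0// -natrD ler_nat; lia.
Qed.

End power_differences.

(** * Complex power series and their real majorants *)

Section complex_power_series.
Context {R : realType}.
Variables (C : R) (a : nat -> R).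
Hypothesis aC : factorially_bounded C a.
Implicit Types (z w : CC R) (r : R).

Let a0 n : 0 <= a n. Proof. by have /andP[] := aC n. Qed.

Lemma norm_pseries_term z r n : `|z| <= r%:C ->
  `|(a n)%:C * z ^+ n| <= (a n * r ^+ n)%:C.
Proof.
move=> zr; rewrite normrM normrX ger0_norm ?ler0c// rmorphM rmorphXn/=.
by rewrite ler_wpM2l ?ler0c// lerXn2r// qualifE/= (le_trans _ zr).
Qed.

Lemma cvg_complex_pseries z :
  series (fun n => (a n)%:C * z ^+ n : CC R) n @[n --> \oo] --> complex_pseries a z.
Proof.
have r0 : 0 <= complex.Re `|z| by rewrite -ler0c -normcE_real.
apply: is_cvg_series_dominated (is_cvg_real_pseries _ _ aC _ r0) => n.
by apply: norm_pseries_term; rewrite -normcE_real.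
Qed.

Lemma complex_pseries_real r : 0 <= r ->
  complex_pseries a r%:C = (real_pseries a r)%:C.
Proof.
move=> r0; apply: cvg_lim => //; apply: cvg_Re_Im.
  apply: cvg_trans (is_cvg_real_pseries _ _ aC _ r0).
  apply: near_eq_cvg; near=> n.
  rewrite /series/= raddf_sum; apply: eq_bigr => i _.
  by rewrite -rmorphXn -rmorphM.
apply: cvg_near_cst; near=> n; rewrite /series/= raddf_sum big1// => i _.
by rewrite -rmorphXn -rmorphM.
Unshelve. all: by end_near. Qed.

Lemma norm_complex_pseries_le z r : `|z| <= r%:C ->
  `|complex_pseries a z| <= (real_pseries a r)%:C.
Proof.
move=> zr; have r0 : 0 <= r by rewrite -ler0c (le_trans _ zr).
apply: norm_lim_le (cvg_complex_pseries z) _; near=> n.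
apply: le_trans (ler_norm_sum _ _ _) _.
apply: (@le_trans _ _ (pseries a r n)%:C).
  by rewrite rmorph_sum/= ler_sum// => i _; exact: norm_pseries_term.
by rewrite lecR (pseries_le_real_pseries _ _ aC).
Unshelve. all: by end_near. Qed.

(** With [a 0 = 1] it gives the lower bound [|2 - S z| >= 1 - |S z - 1| >= 2 - S r]. *)
Lemma norm_complex_pseries_sub0_le z r : `|z| <= r%:C ->
  `|complex_pseries a z - (a 0%N)%:C| <= (real_pseries a r - a 0%N)%:C.
Proof.
move=> zr; have r0 : 0 <= r by rewrite -ler0c (le_trans _ zr).
apply: (norm_lim_le (fun n => series (fun n => (a n)%:C * z ^+ n : CC R) n - (a 0%N)%:C)).
  exact: (cvgB (cvg_complex_pseries z) (cvg_cst ((a 0%N)%:C : CC R))).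
near=> n; have n1 : (1 <= n)%N by near: n; exact: nbhs_infty_ge.
apply: (@le_trans _ _ (pseries a r n - a 0%N)%:C); last first.
  by rewrite lecR lerD2r (pseries_le_real_pseries _ _ aC).
rewrite /pseries/= /series/= -(prednK n1) !big_nat_recl//= !expr0 !mulr1.
rewrite ![_ + \sum_(_ <= _ < _) _]addrC !addrK.
apply: le_trans (ler_norm_sum _ _ _) _.
by rewrite rmorph_sum/= ler_sum// => i _; exact: norm_pseries_term.
Unshelve. all: by end_near. Qed.

End complex_power_series.

(** * Termwise differentiation of complex power series *)

Section complex_power_series_derivative.
Context {R : realType}.
Variables (C : R) (a : nat -> R).
Hypothesis aC : factorially_bounded C a.
Implicit Types (z w : CC R) (r d : R).

Let a0 n : 0 <= a n. Proof. by have /andP[] := aC n. Qed.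
Let a'C := factorially_bounded_diffs _ _ aC.
Let a''C := factorially_bounded_diffs _ _ a'C.

Lemma sum_deriv_le r n : 0 <= r ->
  \sum_(0 <= k < n) a k * (k%:R * r ^+ k.-1) <= real_pseries (pseries_diffs a) r.
Proof.
move=> r0; apply: le_trans (pseries_le_real_pseries _ _ a'C r n r0).
(* The partial sums differ by the boundary term [n a_n r^(n-1)], which is nonnegative. *)
rewrite /pseries/= /series/= pseries_diffs_sumE -[leLHS]addr0 lerD//.
  by apply: ler_sum => k _; rewrite mulrCA mulrA.
by rewrite !mulr_ge0 ?exprn_ge0.
Qed.

Lemma sum_deriv2_le r n : 0 <= r ->
  \sum_(0 <= k < n) a k * ((k * k.-1)%:R * r ^+ k.-2)
  <= real_pseries (pseries_diffs (pseries_diffs a)) r.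
Proof.
move=> r0; case: n => [|n].
  by rewrite big_nil (real_pseries_ge0 _ _ a''C).
rewrite big_nat_recl// mul0r mulr0 add0r.
apply: le_trans (pseries_le_real_pseries _ _ a''C r n r0).
rewrite /pseries/= /series/= pseries_diffs_sumE -[leLHS]addr0 lerD//.
  apply: ler_sum => k _; rewrite /pseries_diffs /= natrM.
  by rewrite le_eqVlt; apply/orP; left; apply/eqP; ring.
by rewrite !mulr_ge0 ?exprn_ge0// ltW.
Qed.

Lemma norm_complex_pseriesB_le z w r d :
  `|z| <= r%:C -> `|w| <= r%:C -> `|w - z| <= d%:C ->
  `|complex_pseries a w - complex_pseries a z|
    <= (d * real_pseries (pseries_diffs a) r)%:C.
Proof.
move=> zr wr wzd; have r0 : 0 <= r by rewrite -ler0c (le_trans _ zr).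
have d0 : 0 <= d by rewrite -ler0c (le_trans _ wzd).
apply: norm_lim_le (cvgB (cvg_complex_pseries _ _ aC w) (cvg_complex_pseries _ _ aC z)) _.
near=> n; rewrite /series/= -sumrB.
apply: le_trans (ler_norm_sum _ _ _) _.
apply: (@le_trans _ _ (d * \sum_(0 <= k < n) a k * (k%:R * r ^+ k.-1))%:C); last first.
  by rewrite lecR ler_wpM2l// sum_deriv_le.
rewrite mulr_sumr rmorph_sum/=; apply: ler_sum => k _.
rewrite -mulrBr normrM ger0_norm ?ler0c// mulrCA rmorphM/= ler_wpM2l ?ler0c//.
apply: le_trans (norm_subX_le _ _ r%:C _ zr wr) _.
rewrite rmorphM [X in _ <= _ * X]rmorphM rmorphXn rmorph_nat/= ler_wpM2r//.
by rewrite mulr_ge0// exprn_ge0// ler0c.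
Unshelve. all: by end_near. Qed.

Lemma cvg_complex_pseries_deriv z :
  (\sum_(0 <= k < n) (a k)%:C * (k%:R * z ^+ k.-1) : CC R) @[n --> \oo]
  --> complex_pseries (pseries_diffs a) z.
Proof.
rewrite -(cvg_shiftS (fun n => \sum_(0 <= k < n) (a k)%:C * (k%:R * z ^+ k.-1) : CC R)).
apply: cvg_trans (cvg_complex_pseries _ _ a'C z).
apply: near_eq_cvg; near=> n.
rewrite /series/= big_nat_recl// mul0r mulr0 add0r; apply: eq_bigr => k _.
by rewrite /pseries_diffs rmorphM rmorph_nat/=; ring.
Unshelve. all: by end_near. Qed.

(** The second-order estimate for powers is summed termwise; the quadratic factor makes the error of
    the difference quotient linear in the increment. *)
Lemma norm_complex_pseries_taylor_le z w r d :
  `|z| <= r%:C -> `|w| <= r%:C -> `|w - z| <= d%:C ->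
  `|complex_pseries a w - complex_pseries a z
    - (w - z) * complex_pseries (pseries_diffs a) z|
    <= (d ^+ 2 * real_pseries (pseries_diffs (pseries_diffs a)) r)%:C.
Proof.
move=> zr wr wzd; have r0 : 0 <= r by rewrite -ler0c (le_trans _ zr).
have d0 : 0 <= d by rewrite -ler0c (le_trans _ wzd).
apply: norm_lim_le (cvgB (cvgB (cvg_complex_pseries _ _ aC w)
  (cvg_complex_pseries _ _ aC z))
  (cvgM (cvg_cst (w - z)) (cvg_complex_pseries_deriv z))) _.
near=> n.
change (`|series (fun n => (a n)%:C * w ^+ n : CC R) n
   - series (fun n => (a n)%:C * z ^+ n : CC R) n
   - (w - z) * \sum_(0 <= k < n) (a k)%:C * (k%:R * z ^+ k.-1)| <=
   (d ^+ 2 * real_pseries (pseries_diffs (pseries_diffs a)) r)%:C).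
rewrite /series/= mulr_sumr -!sumrB.
apply: le_trans (ler_norm_sum _ _ _) _.
apply: (@le_trans _ _ (d ^+ 2 *
    \sum_(0 <= k < n) a k * ((k * k.-1)%:R * r ^+ k.-2))%:C); last first.
  by rewrite lecR ler_wpM2l ?exprn_ge0// sum_deriv2_le.
rewrite mulr_sumr rmorph_sum/=; apply: ler_sum => k _.
rewrite [(w - z) * _]mulrCA -!mulrBr normrM ger0_norm ?ler0c//.
rewrite [d ^+ 2 * _]mulrCA rmorphM/= ler_wpM2l ?ler0c//.
apply: le_trans (norm_subX_taylor_le _ _ r%:C _ zr wr) _.
rewrite !(rmorphM (real_complex R)) rmorph_nat !rmorphXn/= ler_wpM2r//.
  by rewrite mulr_ge0// exprn_ge0// ler0c.
by rewrite expr2 ler_pM.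
Unshelve. all: by end_near. Qed.

Lemma is_derive_complex_pseries z :
  is_derive z 1 (complex_pseries a) (complex_pseries (pseries_diffs a) z).
Proof.
set f := complex_pseries a; set f' := complex_pseries _ z.
suff h : (fun h : CC R => h^-1 *: (f (h *: (1 : CC R) + z) - f z)) @ (0 : CC R)^' --> f'.
  by split; [apply/cvg_ex; exists f'|exact: cvg_lim].
(* The disc of this radius contains [h + z] as soon as [|h| < 1]. *)
pose r := complex.Re `|z| + 1.
pose M := real_pseries (pseries_diffs (pseries_diffs a)) r.
have r0 : 0 <= r by rewrite addr_ge0// -ler0c -normcE_real.
have M0 : 0 <= M by apply: (real_pseries_ge0 _ _ a''C).
apply/cvgrPdist_le => _ /complex_gt0E[e e0 ->].
(* The denominator [M + 1] stays positive even if [M = 0]. *)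
have eM : 0 < e / (M + 1) by rewrite divr_gt0// ltr_wpDl.
near=> h.
have h0 : h != 0 by near: h; exact: nbhs_dnbhs_neq.
have h1 : `|h| < 1%:C.
  by near: h; apply: dnbhs0_lt; rewrite ltcR.
have he : `|h| < (e / (M + 1))%:C.
  by near: h; apply: dnbhs0_lt; rewrite ltcR.
have hd : `|h| <= (complex.Re `|h|)%:C by rewrite -normcE_real.
have zr : `|z| <= r%:C by rewrite normcE_real lecR lerDl.
have wr : `|h + z| <= r%:C.
  rewrite (le_trans (ler_normD _ _))// addrC rmorphD/= lerD//.
  exact: ltW.
have := norm_complex_pseries_taylor_le z (h + z) r (complex.Re `|h|) zr wr.
rewrite addrK => /(_ hd); rewrite -/f -/f' -/M => T.
have -> : f' - h^-1 *: (f (h *: 1 + z) - f z) =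
  - (h^-1 * (f (h + z) - f z - h * f')).
  rewrite (_ : h *: 1 = h) ?[h *: 1]mulr1// mulrBr mulKf// opprB.
  by [].
rewrite normrN normrM normfV ler_pdivrMl ?normr_gt0//.
apply: le_trans T _; rewrite rmorphM rmorphXn/= -normcE_real expr2 -mulrA.
rewrite ler_wpM2l//; apply: (@le_trans _ _ ((e / (M + 1))%:C * M%:C)).
  by rewrite ler_wpM2r ?ler0c// ltW.
rewrite -rmorphM lecR mulrAC ler_pdivrMr ?ltr_wpDl//.
by rewrite ler_wpM2l ?ltW// ltrDl.
Unshelve. all: by end_near. Qed.

End complex_power_series_derivative.

(** * Starlikeness and convexity criteria *)

Section quotient_criterion.
Context {R : realType}.
Variables (alpha : R) (p q : R -> R) (P Q : CC R -> CC R).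
Hypotheses (alpha1 : alpha < 1).
Hypotheses (P_derivable : forall z, derivable P z 1)
  (Q_derivable : forall z, derivable Q z 1).
Hypotheses (P_real : forall r, 0 <= r -> P r%:C = (p r)%:C)
  (Q_real : forall r, 0 <= r -> Q r%:C = (q r)%:C).
Hypotheses (P_le : forall z r, `|z| <= r%:C -> `|P z - 1| <= (p r - 1)%:C)
  (Q_le : forall z r, `|z| <= r%:C -> `|Q z| <= (q r)%:C).
Hypotheses (p_cont : continuous p) (q_cont : continuous q).
Hypotheses (p_mono : forall r s, 0 <= r <= s -> p r <= p s)
  (q_mono : forall r s, 0 <= r < s -> q r < q s).
Hypotheses (p0 : p 0 = 1) (q0 : q 0 = 0).

(** The witness is [2 - p r] with [r = |z| < 1]. Strict growth of [q] makes the inequality strict at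
    [r], and [0 <= q r < (1 - alpha) * (2 - p r)] makes the witness positive. *)
Lemma criterion_bounds (z : CC R) : q 1 + (1 - alpha) * p 1 <= 2 * (1 - alpha) ->
  unit_disc z -> exists2 x : R, 0 < x &
    x%:C <= `|2 - P z| /\ `|Q z| < ((1 - alpha) * x)%:C.
Proof.
move=> H z1; pose r := complex.Re `|z|.
have zr : `|z| <= r%:C by rewrite -normcE_real.
have r0 : 0 <= r by rewrite -ler0c (le_trans _ zr).
have r1 : r < 1 by rewrite -ltcR -normcE_real.
have a1 : 0 < 1 - alpha by rewrite subr_gt0.
have qr : q r < q 1 by rewrite q_mono// r0.
have pr : p r <= p 1 by rewrite p_mono// r0 ltW.
have qr0 : 0 <= q r by rewrite -ler0c (le_trans _ (Q_le z r zr)).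
have qp : q r < (1 - alpha) * (2 - p r).
  have : (1 - alpha) * p r <= (1 - alpha) * p 1 by rewrite ler_wpM2l// ltW.
  lra.
exists (2 - p r); first by rewrite -(pmulr_rgt0 _ a1) (le_lt_trans qr0).
split; last by rewrite (le_lt_trans (Q_le z r zr))// ltcR.
have -> : 2 - P z = 1 - (P z - 1) by ring.
apply: le_trans (lerB_dist _ _); rewrite normr1 lerBrDr.
rewrite (le_trans (lerD (lexx _) (P_le z r zr)))// -rmorphD/=.
by rewrite (_ : 2 - p r + (p r - 1) = 1)//; ring.
Qed.

Lemma quotient_criterion :
  (exists g : CC R -> CC R,
    regular_quotient (fun z => z * (2 - P z - Q z)) (fun z => z * (2 - P z)) g /\
    (forall z, unit_disc z -> alpha < complex.Re (g z))) <->
  q 1 + (1 - alpha) * p 1 <= 2 * (1 - alpha).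
Proof.
split=> [[g [[_ _ gE] galpha]]|H]; last first.
  have D0 z : unit_disc z -> 2 - P z != 0.
    move=> /(criterion_bounds _ H)[x x0 [xD _]].
    by rewrite -normr_gt0 (lt_le_trans _ xD)// ltcR.
  exists (fun z => 1 - Q z / (2 - P z)); split; [split|].
  - move=> z z1; apply: derivableB; first exact: derivable_cst.
    apply: derivableM; first exact: Q_derivable.
    apply: derivableV; first exact: D0.
    by apply: derivableB; [exact: derivable_cst|exact: P_derivable].
  - by rewrite (Q_real 0)// q0 mul0r subr0.
  - move=> z z1; rewrite mulf_eq0 negb_or => /andP[z0 Dz].
    by field; rewrite z0 Dz.
  - move=> z z1; have [x x0 [xD Qx]] := criterion_bounds z H z1.
    (* It suffices that the real part of [Q z / (2 - P z)] is below [1 - alpha], and the modulus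
       already is. *)
    rewrite raddfB/= ltrBrDl -ltrBrDr.
    rewrite -ltcR (le_lt_trans _ (_ : `|Q z / (2 - P z)| < _))//.
      by rewrite (le_trans _ (normc_ge_Re _))// lecR ler_norm.
    rewrite normf_div ltr_pdivrMr ?normr_gt0 ?D0// (lt_le_trans Qx)//.
    by rewrite rmorphM/= ler_wpM2l// ler0c subr_ge0 ltW.
have a1 : 0 < 1 - alpha by rewrite subr_gt0.
(* If the inequality fails, the margin [G] goes from [1 - alpha > 0] at 0 to a negative value at 1,
   so it has a zero strictly between. *)
rewrite leNgt; apply/negP => H.
pose G r := 2 * (1 - alpha) - q r - (1 - alpha) * p r.
have G_cont : continuous G.
  move=> r; apply: cvgB; last by apply: cvgM; [exact: cvg_cst|exact: p_cont].
  by apply: cvgB; [exact: cvg_cst|exact: q_cont].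
have G0 : G 0 = 1 - alpha by rewrite /G q0 p0; ring.
have G1 : G 1 < 0 by rewrite /G; lra.
have [c cin Gc] : exists2 c, c \in `[0, 1]%R & G c = 0.
  apply: IVT => //; first exact: continuous_subspaceT.
  by rewrite G0 ge_min le_max (ltW G1) (ltW a1) orbT.
move: cin; rewrite in_itv/= => /andP[].
rewrite le_eqVlt => /predU1P[c0|c0]; first by move: Gc a1; rewrite -c0 G0; lra.
rewrite le_eqVlt => /predU1P[c1|c1]; first by move: Gc G1; rewrite c1; lra.
(* At the zero [c] of [G], [q c > 0] forces [2 - p c > 0]. The denominator is therefore nonzero at
   [c], and [g] takes there the value of the actual quotient, [1 - q c / (2 - p c) = alpha]. *)
have qc : 0 < q c by rewrite -q0 q_mono// lexx.
have Dc : q c = (1 - alpha) * (2 - p c) by move: Gc; rewrite /G; lra.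
have pc : 0 < 2 - p c by move: qc; rewrite Dc pmulr_rgt0.
have cd : unit_disc (c%:C : CC R).
  by rewrite /unit_disc/= ger0_norm ?ler0c ?(ltW c0)// ltcR.
have := galpha _ cd; rewrite gE//; rewrite P_real ?(ltW c0)//; last first.
  rewrite mulf_neq0//; first by rewrite gt_eqF// ltcR.
  by rewrite (_ : 2 - _ = (2 - p c)%:C) ?gt_eqF ?ltcR// rmorphB/= rmorph_nat.
rewrite Q_real ?(ltW c0)//.
have -> : c%:C * (2 - (p c)%:C - (q c)%:C) / (c%:C * (2 - (p c)%:C)) = alpha%:C.
  rewrite -(rmorph_nat (real_complex R)) -!rmorphB -!rmorphM/= -fmorphV -rmorphM/=.
  congr (_%:C); rewrite Dc; field.
  by rewrite !gt_eqF.
by rewrite /= ltxx.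
Qed.

End quotient_criterion.

(** * Coefficients of the Bessel-Struve kernel *)

Section bessel_struve_coefficients.
Context {R : realType}.
Variable nu : R.

Lemma bessel_struve_coef0 : - (1 / 2) < nu -> bessel_struve_coef nu 0 = 1.
Proof.
move=> hnu.
have s0 : Num.sqrt (pi : R) != 0 by rewrite gt_eqF// sqrtr_gt0 pi_gt0.
have G0 : Gamma (nu + 1) != 0 by rewrite gt_eqF// Gamma_gt0//; lra.
rewrite /bessel_struve_coef add0r mul0r add0r Gamma_half mulr1.
by rewrite [Num.sqrt _ * _]mulrC divff// mulf_neq0.
Qed.

Lemma bessel_struve_coef_gt0 n :
  - (1 / 2) < nu -> 0 < bessel_struve_coef nu n.
Proof.
move=> hnu.
have n0 : 0 <= n%:R :> R by [].
rewrite /bessel_struve_coef divr_gt0// !mulr_gt0// ?Gamma_gt0 ?sqrtr_gt0 ?pi_gt0//; lra.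
Qed.

Lemma bessel_struve_coef_bounded : - (1 / 2) < nu ->
  exists C, factorially_bounded C (bessel_struve_coef nu).
Proof.
move=> hnu.
pose k : R := expR (- 2) / 2.
have k0 : 0 < k by rewrite divr_gt0 ?expR_gt0.
exists (Gamma (nu + 1) * (Num.sqrt pi / k + 1) / Num.sqrt pi) => n.
rewrite ltW ?bessel_struve_coef_gt0//=.
have n0 : 0 <= n%:R :> R by [].
have g1 : 1 / 2 <= (n%:R + 1) / 2 :> R by lra.
have g2 : 1 / 2 <= n%:R / 2 + nu + 1 by lra.
have s0 : 0 < Num.sqrt (pi : R) by rewrite sqrtr_gt0 pi_gt0.
have G1 : 0 < Gamma (nu + 1) by rewrite Gamma_gt0//; lra.
have G2 : 0 < Gamma (n%:R / 2 + nu + 1) by rewrite Gamma_gt0.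
have f0 : 0 < n`!%:R :> R by rewrite ltr0n fact_gt0.
(* The two arguments differ by [nu + 1/2], which is nonnegative by the hypothesis on [nu]. The extra
   [Num.sqrt pi] of the shift is absorbed by the uniform lower bound [k] on Gamma. *)
have le : Gamma ((n%:R + 1) / 2) <= (Num.sqrt pi / k + 1) * Gamma (n%:R / 2 + nu + 1).
  have d0 : 0 <= nu + 1 / 2 by lra.
  apply: le_trans (Gamma_le_shift _ _ g1 d0) _.
  rewrite (_ : (n%:R + 1) / 2 + (nu + 1 / 2) = n%:R / 2 + nu + 1); last by field.
  rewrite mulrDl mul1r lerD2r mulrAC ler_pdivlMr// ler_pM2l//.
  exact: Gamma_ge.
rewrite /bessel_struve_coef ler_pdivrMr ?mulr_gt0//.
rewrite (le_trans (ler_wpM2l (ltW G1) le))//.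
by rewrite le_eqVlt; apply/orP; left; apply/eqP; field; rewrite !gt_eqF.
Qed.

End bessel_struve_coefficients.

(** * Weighted sums of the terms [z^k S^(k)] *)

Section weighted_derivative_sum.
Context {R : realType}.
Variables (C : R) (a : nat -> R).
Hypothesis aC : factorially_bounded C a.
Implicit Types (z : CC R) (r s c : R).

Let aC1 := factorially_bounded_diffs _ _ aC.
Let aC2 := factorially_bounded_diffs _ _ aC1.
Let aC3 := factorially_bounded_diffs _ _ aC2.

(** For both classes, [P - S] and [Q] are such sums and differ only in their weights. *)
Definition complex_deriv_sum c1 c2 c3 z : CC R :=
  c1%:C * (z * complex_pseries (pseries_diffs a) z)
  + c2%:C * (z ^+ 2 * complex_pseries (pseries_diffs (pseries_diffs a)) z)
  + c3%:C * (z ^+ 3 * complex_pseries (pseries_diffs (pseries_diffs (pseries_diffs a))) z).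

Definition real_deriv_sum c1 c2 c3 r : R :=
  c1 * (r * real_pseries (pseries_diffs a) r)
  + c2 * (r ^+ 2 * real_pseries (pseries_diffs (pseries_diffs a)) r)
  + c3 * (r ^+ 3 * real_pseries (pseries_diffs (pseries_diffs (pseries_diffs a))) r).

Lemma derivable_complex_pseries (C' : R) b z :
  factorially_bounded C' b -> derivable (complex_pseries b) z 1.
Proof. by move=> bC; have [] := is_derive_complex_pseries _ _ bC z. Qed.

Lemma derivable_complex_deriv_sum c1 c2 c3 z :
  derivable (complex_deriv_sum c1 c2 c3) z 1.
Proof.
have term (C' c : R) n b : factorially_bounded C' b ->
    derivable (fun z : CC R => c%:C * (z ^+ n * complex_pseries b z) : CC R) z 1.
  move=> bC; apply: derivableM; first exact: derivable_cst.
  apply: derivableM; last exact: derivable_complex_pseries bC.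
  exact: exprn_derivable.
apply: derivableD; last exact: term aC3.
by apply: derivableD; [exact: (term _ _ 1%N _ aC1)|exact: term aC2].
Qed.

Lemma complex_deriv_sum_real c1 c2 c3 r : 0 <= r ->
  complex_deriv_sum c1 c2 c3 r%:C = (real_deriv_sum c1 c2 c3 r)%:C.
Proof.
move=> r0; rewrite /complex_deriv_sum /real_deriv_sum.
rewrite (complex_pseries_real _ _ aC1)// (complex_pseries_real _ _ aC2)//.
by rewrite (complex_pseries_real _ _ aC3)// !rmorphD !rmorphM.
Qed.

Lemma continuous_real_deriv_sum c1 c2 c3 : continuous (real_deriv_sum c1 c2 c3).
Proof.
have term (C' c : R) n b : factorially_bounded C' b ->
    continuous (fun r : R => c * (r ^+ n * real_pseries b r)).
  move=> bC r; apply: cvgM; first exact: cvg_cst.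
  apply: cvgM; last exact: (continuous_real_pseries _ _ bC).
  exact: exprn_continuous.
move=> r; apply: cvgD; last exact: (term _ _ _ _ aC3).
by apply: cvgD; [exact: (term _ _ 1%N _ aC1)|exact: (term _ _ _ _ aC2)].
Qed.

Section nonneg.
Variables c1 c2 c3 : R.
Hypotheses (c10 : 0 <= c1) (c20 : 0 <= c2) (c30 : 0 <= c3).

Lemma norm_complex_deriv_sum_le z r : `|z| <= r%:C ->
  `|complex_deriv_sum c1 c2 c3 z| <= (real_deriv_sum c1 c2 c3 r)%:C.
Proof.
move=> zr.
have term (C' c : R) n b : factorially_bounded C' b -> 0 <= c ->
    `|c%:C * (z ^+ n * complex_pseries b z)| <= (c * (r ^+ n * real_pseries b r))%:C.
  move=> bC c0; rewrite normrM ger0_norm ?ler0c// rmorphM/= ler_wpM2l ?ler0c//.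
  rewrite normrM normrX rmorphM rmorphXn/= ler_pM//.
    by rewrite lerXn2r// qualifE/= (le_trans _ zr).
  exact: (norm_complex_pseries_le _ _ bC).
rewrite !rmorphD/=; apply: le_trans (ler_normD _ _) _.
apply: lerD; last exact: (term _ _ _ _ aC3).
apply: le_trans (ler_normD _ _) _; apply: lerD; last exact: (term _ _ _ _ aC2).
exact: (term _ _ 1%N _ aC1).
Qed.

Let term_le (C' c : R) n b r s : factorially_bounded C' b -> 0 <= c -> 0 <= r <= s ->
  c * (r ^+ n * real_pseries b r) <= c * (s ^+ n * real_pseries b s).
Proof.
move=> bC c0 /[dup] rs /andP[r0 rs']; have s0 := le_trans r0 rs'.
rewrite ler_wpM2l// ler_pM ?exprn_ge0// ?(real_pseries_ge0 _ _ bC)//.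
  by rewrite lerXn2r// qualifE.
rewrite -subr_ge0; apply: le_trans (real_pseries_increment _ _ bC _ _ rs).
by have /andP[b1 _] := bC 1%N; rewrite mulr_ge0// subr_ge0.
Qed.

Lemma real_deriv_sum_mono r s : 0 <= r <= s ->
  real_deriv_sum c1 c2 c3 r <= real_deriv_sum c1 c2 c3 s.
Proof.
move=> rs; apply: lerD; last exact: (term_le _ _ _ _ _ _ aC3).
by apply: lerD; [exact: (term_le _ _ 1%N _ _ _ aC1)|exact: (term_le _ _ _ _ _ _ aC2)].
Qed.

(** Strictness comes from the term [r * S' r] alone: [S'] is nondecreasing, and [S' s > 0] because
    its constant coefficient is [a 1]. *)
Lemma real_deriv_sum_smono r s : 0 < a 1%N -> 0 < c1 -> 0 <= r < s ->
  real_deriv_sum c1 c2 c3 r < real_deriv_sum c1 c2 c3 s.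
Proof.
move=> a1 c1p /andP[r0 rs]; have rs' : 0 <= r <= s by rewrite r0 ltW.
apply: ltr_leD; last exact: (term_le _ _ _ _ _ _ aC3).
apply: ltr_leD; last exact: (term_le _ _ _ _ _ _ aC2).
rewrite ltr_pM2l//.
have s0 : 0 < s by exact: le_lt_trans rs.
have p0 : 0 < real_pseries (pseries_diffs a) s.
  apply: lt_le_trans (pseries_le_real_pseries _ _ aC1 s 1 (ltW s0)).
  by rewrite /pseries/= /series/= big_nat1 expr0 mulr1 /pseries_diffs mul1r.
apply: (@le_lt_trans _ _ (r * real_pseries (pseries_diffs a) s)).
  rewrite ler_wpM2l// -subr_ge0.
  apply: le_trans (real_pseries_increment _ _ aC1 _ _ rs').
  by have /andP[b1 _] := aC1 1%N; rewrite mulr_ge0// subr_ge0 ltW.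
by rewrite ltr_pM2r.
Qed.

End nonneg.

Lemma real_deriv_sum0 c1 c2 c3 : real_deriv_sum c1 c2 c3 0 = 0.
Proof. by rewrite /real_deriv_sum !expr0n/= !mul0r !mulr0 !addr0. Qed.

End weighted_derivative_sum.

(** * The first three derivatives of [Phi] *)

Section z_times_two_minus_pseries.
Context {R : realType}.
Variables (C : R) (a : nat -> R).
Hypothesis aC : factorially_bounded C a.
Implicit Types (z w : CC R) (r s c : R).

Let aC1 := factorially_bounded_diffs _ _ aC.
Let aC2 := factorially_bounded_diffs _ _ aC1.

Notation S0 := (complex_pseries a).
Notation S1 := (complex_pseries (pseries_diffs a)).
Notation S2 := (complex_pseries (pseries_diffs (pseries_diffs a))).
Notation S3 := (complex_pseries (pseries_diffs (pseries_diffs (pseries_diffs a)))).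
Notation Phi := (fun z : CC R => z * (2 - S0 z)).

Lemma derive1_complex_pseries : S0^`()%classic = S1.
Proof.
apply/funext => z; rewrite derive1E.
by have [_] := is_derive_complex_pseries _ _ aC z.
Qed.

Lemma is_derive_Phi z : is_derive z 1 Phi (2 - S0 z - z * S1 z).
Proof.
have dS := is_derive_complex_pseries _ _ aC z.
apply: is_derive_eq.
rewrite /GRing.scale/=; ring.
Qed.

Lemma derive1_Phi : Phi^`()%classic = (fun z => 2 - S0 z - z * S1 z).
Proof. by apply/funext => z; rewrite derive1E; have [_] := is_derive_Phi z. Qed.

Lemma derive2_Phi : (fun z => 2 - S0 z - z * S1 z)^`()%classic =
  (fun z => - (2 * S1 z) - z * S2 z).
Proof.
apply/funext => z; rewrite derive1E.
have dS := is_derive_complex_pseries _ _ aC z.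
have dS1 := is_derive_complex_pseries _ _ aC1 z.
apply: derive_val.
apply: is_derive_eq.
rewrite /GRing.scale/=; ring.
Qed.

Lemma derive3_Phi : (fun z => - (2 * S1 z) - z * S2 z)^`()%classic =
  (fun z => - (3 * S2 z) - z * S3 z).
Proof.
apply/funext => z; rewrite derive1E.
have dS1 := is_derive_complex_pseries _ _ aC1 z.
have dS2 := is_derive_complex_pseries _ _ aC2 z.
apply: derive_val.
apply: is_derive_eq.
rewrite /GRing.scale/=; ring.
Qed.

End z_times_two_minus_pseries.

(** * Membership of [Phi] in the classes [classA] and [classJ] *)

Section univalence_and_coefficients.
Context {R : realType}.
Variables (C : R) (a : nat -> R).
Hypotheses (aC : factorially_bounded C a).
Hypotheses (a_init : a 0%N = 1) (a_gt0 : forall n, 0 < a n).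
Implicit Types (z w : CC R) (r s c : R).

Let aC1 := factorially_bounded_diffs _ _ aC.

Notation S0 := (complex_pseries a).
Notation Phi := (fun z : CC R => z * (2 - S0 z)).

(** If [Phi z = Phi w], then [(w - z) (2 - S w) = z (S w - S z)]. On the disc of radius [r < 1] the
    function [S] is Lipschitz with constant [S' r], so [w != z] would give [2 - S r <= S' r]. But
    [S r + S' r < S 1 + S' 1 <= 2], strictly since [a 1 > 0]. *)
Lemma Phi_injective :
  real_pseries a 1 + real_pseries (pseries_diffs a) 1 <= 2 ->
  set_inj (@unit_disc R) Phi.
Proof.
move=> H z w; rewrite !inE => z1 w1 eqPhi; apply/eqP; rewrite eq_sym.
apply/negPn/negP => wz.
pose r := Num.max (complex.Re `|z|) (complex.Re `|w|).
have zr : `|z| <= r%:C by rewrite normcE_real lecR le_max lexx.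
have wr : `|w| <= r%:C by rewrite normcE_real lecR le_max lexx orbT.
have r0 : 0 <= r by rewrite -ler0c (le_trans _ zr).
have r1 : r < 1 by rewrite gt_max -!ltcR -!normcE_real; apply/andP.
have E : (w - z) * (2 - S0 w) = z * (S0 w - S0 z).
  have alg (x y A B : R[i]) : x * (2 - A) = y * (2 - B) ->
      (y - x) * (2 - B) = x * (B - A).
    move=> h; rewrite mulrBl -h -mulrBr.
    by rewrite opprD opprK addrACA subrr add0r addrC.
  exact: alg.
have d0 : 0 < `|w - z| by rewrite normr_gt0 subr_eq0.
have S0w : (2 - real_pseries a r)%:C <= `|2 - S0 w|.
  have -> : 2 - S0 w = 1 - (S0 w - (a 0%N)%:C) by rewrite a_init; ring.
  apply: le_trans (lerB_dist _ _); rewrite normr1 lerBrDr.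
  rewrite (le_trans (lerD (lexx _) (norm_complex_pseries_sub0_le _ _ aC _ _ wr)))//.
  rewrite -rmorphD/= a_init (_ : 2 - real_pseries a r + (real_pseries a r - 1) = 1)//.
  by ring.
have L := norm_complex_pseriesB_le _ _ aC z w r (complex.Re `|w - z|) zr wr.
have {L} := L _; rewrite -normcE_real => /(_ (lexx _)).
rewrite rmorphM/= -normcE_real => L.
have : `|w - z| * `|2 - S0 w| <= `|w - z| * (real_pseries (pseries_diffs a) r)%:C.
  have alg (d u x v M : R[i]) : d * u = x * v -> `|x| <= 1 ->
      `|v| <= `|d| * M -> `|d| * `|u| <= `|d| * M.
    move=> duxv x1 vM; rewrite -normrM duxv normrM; apply: le_trans vM.
    by rewrite ler_piMl.
  exact: alg E (ltW z1) L.
rewrite ler_pM2l// => /(le_trans S0w); rewrite lecR.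
have le1 : real_pseries (pseries_diffs a) r <= real_pseries (pseries_diffs a) 1.
  rewrite -subr_ge0; apply: le_trans (real_pseries_increment _ _ aC1 r 1 _).
    by have /andP[b1 _] := aC1 1%N; rewrite mulr_ge0// subr_ge0 ltW.
  by rewrite r0 ltW.
have lt0 : real_pseries a r < real_pseries a 1.
  rewrite -subr_gt0; apply: lt_le_trans (real_pseries_increment _ _ aC r 1 _).
    by rewrite mulr_gt0// subr_gt0.
  by rewrite r0 ltW.
by lra.
Qed.

Lemma Phi_classA :
  real_pseries a 1 + real_pseries (pseries_diffs a) 1 <= 2 -> classA Phi.
Proof.
move=> H; split.
- by move=> z _; have [] := is_derive_Phi _ _ aC z.
- exact: Phi_injective.
- by rewrite mul0r.
- rewrite /derive1n/= (derive1_Phi _ _ aC) mul0r subr0.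
  by rewrite (complex_pseries_real _ _ aC 0)// real_pseries0// a_init; ring.
Qed.

Lemma Phi_classJ : classJ Phi.
Proof.
split; first by move=> z _; have [] := is_derive_Phi _ _ aC z.
(* As [a 0 = 1], [z (2 - S z)] is [z] minus the sum of [a_n z^(n+1)] over [n >= 1]. Shifting by 2
   matches its partial sums with those of [S] up to [n + 1] terms, less the constant term. *)
exists (fun n => a n.-1); split => // z _.
rewrite -(cvg_shiftn 2 (fun n => z - \sum_(2 <= k < n) (a k.-1)%:C * z ^+ k : CC R)).
have c0 := cvg_complex_pseries _ _ aC z.
have -> : z * (2 - S0 z) = z - z * (S0 z - 1) by ring.
have c1 : (series (fun n => (a n)%:C * z ^+ n : CC R) n.+1) @[n --> \oo] --> S0 z.
  by rewrite (cvg_shiftS (series (fun n => (a n)%:C * z ^+ n : CC R))).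
apply: cvg_trans (cvgB (cvg_cst z) (cvgM (cvg_cst z) (cvgB c1 (cvg_cst (1 : CC R))))).
apply: near_eq_cvg; near=> n.
change (z - z * (series (fun n => (a n)%:C * z ^+ n : CC R) n.+1 - 1) =
  z - \sum_(2 <= k < n + 2) (a k.-1)%:C * z ^+ k).
rewrite /series/= big_nat_recl// a_init expr0 mulr1 rmorph1.
rewrite [1 + _]addrC addrK mulr_sumr; congr (_ - _).
rewrite addn2 !big_add1 /=; apply: eq_bigr => i _.
by rewrite [z ^+ i.+2]exprS mulrCA.
Unshelve. all: by end_near. Qed.

End univalence_and_coefficients.

(** * The criterion applied to the two classes *)

Section starlike_and_convex_classes.
Context {R : realType}.
Variables (C alpha lambda : R) (a : nat -> R).
Hypotheses (aC : factorially_bounded C a).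
Hypotheses (a_init : a 0%N = 1) (a_gt0 : forall n, 0 < a n).
Hypotheses (alpha0 : 0 <= alpha) (alpha1 : alpha < 1).
Hypothesis lambda0 : 0 <= lambda.

Let aC1 := factorially_bounded_diffs _ _ aC.
Let aC2 := factorially_bounded_diffs _ _ aC1.
Let aC3 := factorially_bounded_diffs _ _ aC2.

Notation S0 := (complex_pseries a).
Notation S1 := (complex_pseries (pseries_diffs a)).
Notation S2 := (complex_pseries (pseries_diffs (pseries_diffs a))).
Notation S3 := (complex_pseries (pseries_diffs (pseries_diffs (pseries_diffs a)))).
Notation s0 := (real_pseries a 1).
Notation s1 := (real_pseries (pseries_diffs a) 1).
Notation s2 := (real_pseries (pseries_diffs (pseries_diffs a)) 1).
Notation s3 := (real_pseries (pseries_diffs (pseries_diffs (pseries_diffs a))) 1).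
Notation Phi := (fun z : CC R => z * (2 - S0 z)).

(** An instance of [quotient_criterion], the [b] being the weights of [P - S] and the [c] those of
    [Q]. Positivity of [c1] makes [q] strictly increasing. *)
Lemma deriv_sum_criterion (b1 b2 b3 c1 c2 c3 : R) :
  0 <= b1 -> 0 <= b2 -> 0 <= b3 -> 0 < c1 -> 0 <= c2 -> 0 <= c3 ->
  (exists g : CC R -> CC R,
    regular_quotient
      (fun z => z * (2 - (S0 z + complex_deriv_sum a b1 b2 b3 z)
                     - complex_deriv_sum a c1 c2 c3 z))
      (fun z => z * (2 - (S0 z + complex_deriv_sum a b1 b2 b3 z))) g /\
    (forall z, unit_disc z -> alpha < complex.Re (g z))) <->
  real_deriv_sum a c1 c2 c3 1
    + (1 - alpha) * (s0 + real_deriv_sum a b1 b2 b3 1) <= 2 * (1 - alpha).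
Proof.
move=> b10 b20 b30 c10 c20 c30.
apply: (quotient_criterion alpha
  (fun r => real_pseries a r + real_deriv_sum a b1 b2 b3 r) (real_deriv_sum a c1 c2 c3)
  (fun z => S0 z + complex_deriv_sum a b1 b2 b3 z) (complex_deriv_sum a c1 c2 c3)).
- exact: alpha1.
- move=> z; apply: derivableD; first exact: (derivable_complex_pseries _ _ _ aC).
  exact: (derivable_complex_deriv_sum _ _ aC).
- by move=> z; exact: (derivable_complex_deriv_sum _ _ aC).
- move=> r r0; rewrite rmorphD/= -(complex_pseries_real _ _ aC)//.
  by rewrite (complex_deriv_sum_real _ _ aC).
- by move=> r r0; rewrite (complex_deriv_sum_real _ _ aC).
- move=> z r zr; rewrite addrAC [X in _ <= X%:C]addrAC (rmorphD (real_complex R)).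
  apply: le_trans (ler_normD _ _) _; apply: lerD.
    have := norm_complex_pseries_sub0_le _ _ aC z r zr.
    by rewrite a_init.
  exact: (norm_complex_deriv_sum_le _ _ aC).
- by move=> z r zr; exact: (norm_complex_deriv_sum_le _ _ aC _ _ _ (ltW c10)).
- move=> r; apply: cvgD; first exact: (continuous_real_pseries _ _ aC).
  exact: (continuous_real_deriv_sum _ _ aC).
- exact: (continuous_real_deriv_sum _ _ aC).
- move=> r s rs; apply: lerD; last exact: (real_deriv_sum_mono _ _ aC).
  rewrite -subr_ge0; apply: le_trans (real_pseries_increment _ _ aC _ _ rs).
  by rewrite mulr_ge0 ?(ltW (a_gt0 _))// subr_ge0; case/andP: rs.
- by move=> r s rs; apply: (real_deriv_sum_smono _ _ aC).
- by rewrite real_pseries0 a_init real_deriv_sum0 addr0.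
- exact: real_deriv_sum0.
Qed.

Lemma classT_star_Phi : classT_star lambda alpha Phi <->
  lambda * s2 + (1 - lambda * alpha + 2 * lambda) * s1 + (1 - alpha) * s0
  <= 2 * (1 - alpha).
Proof.
have s10 : 0 <= s1 := real_pseries_ge0 _ _ aC1 _ ler01.
have s20 : 0 <= s2 := real_pseries_ge0 _ _ aC2 _ ler01.
(* The denominator of the quotient is [z (2 - S - lambda z S')], and it exceeds the numerator by
   [z ((1 + lambda) z S' + lambda z^2 S'')]. *)
have := deriv_sum_criterion lambda 0 0 (1 + lambda) lambda 0 lambda0 (lexx _) (lexx _)
  (ltr_pwDl ltr01 lambda0) lambda0 (lexx _).
rewrite /real_deriv_sum !expr1n !mul1r !mul0r !addr0.
have -> : (1 + lambda) * s1 + lambda * s2 + (1 - alpha) * (s0 + lambda * s1) =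
  lambda * s2 + (1 - lambda * alpha + 2 * lambda) * s1 + (1 - alpha) * s0 by ring.
have -> : (fun z => z * (2 - (S0 z + complex_deriv_sum a lambda 0 0 z)
                     - complex_deriv_sum a (1 + lambda) lambda 0 z)) =
  (fun z => z * derive1n 1 Phi z + lambda%:C * z ^+ 2 * derive1n 2 Phi z).
  apply/funext => z; rewrite /derive1n/= (derive1_Phi _ _ aC) (derive2_Phi _ _ aC).
  by rewrite /complex_deriv_sum !rmorphD !rmorph0 rmorph1/=; ring.
have -> : (fun z => z * (2 - (S0 z + complex_deriv_sum a lambda 0 0 z))) =
  (fun z => (1 - lambda)%:C * Phi z + lambda%:C * z * derive1n 1 Phi z).
  apply/funext => z; rewrite /derive1n/= (derive1_Phi _ _ aC).
  by rewrite /complex_deriv_sum !rmorphB !rmorph0 rmorph1/=; ring.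
move=> crit; split=> [[[_ /crit//] _]|H]; split; last exact: Phi_classJ aC _ _.
split; last exact/crit.
apply: (Phi_classA _ _ aC) => //.
(* After scaling by [1 - alpha], the assumed inequality exceeds the goal by a nonnegative multiple
   of [s2] and by [alpha + lambda (2 - alpha)] times [s1]. *)
rewrite -(ler_pM2l (_ : 0 < 1 - alpha)) ?subr_gt0//.
have : 0 <= lambda * s2 by rewrite mulr_ge0.
have : 0 <= (alpha + lambda * (2 - alpha)) * s1.
  by rewrite mulr_ge0// addr_ge0// mulr_ge0// subr_ge0; have := alpha1; lra.
by have := H; lra.
Qed.

Lemma classL_star_Phi : classL_star lambda alpha Phi <->
  lambda * s3 + (5 * lambda + 1 - lambda * alpha) * s2
  + (4 * lambda - 2 * lambda * alpha - alpha + 3) * s1 + (1 - alpha) * s0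
  <= 2 * (1 - alpha).
Proof.
have s10 : 0 <= s1 := real_pseries_ge0 _ _ aC1 _ ler01.
have s20 : 0 <= s2 := real_pseries_ge0 _ _ aC2 _ ler01.
have s30 : 0 <= s3 := real_pseries_ge0 _ _ aC3 _ ler01.
have b10 : 0 <= 1 + 2 * lambda by have := lambda0; lra.
have c10 : 0 < 2 + 2 * lambda by have := lambda0; lra.
have c20 : 0 <= 1 + 4 * lambda by have := lambda0; lra.
(* Here the denominator is [z (2 - S - (1 + 2 lambda) z S' - lambda z^2 S'')]. Its excess over the
   numerator, divided by [z], has weights [2 + 2 lambda], [1 + 4 lambda] and [lambda]. *)
have := deriv_sum_criterion _ _ 0 _ _ _ b10 lambda0 (lexx _) c10 c20 lambda0.
rewrite /real_deriv_sum !expr1n !mul1r !mul0r !addr0.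
have -> : (2 + 2 * lambda) * s1 + (1 + 4 * lambda) * s2 + lambda * s3
    + (1 - alpha) * (s0 + ((1 + 2 * lambda) * s1 + lambda * s2)) =
  lambda * s3 + (5 * lambda + 1 - lambda * alpha) * s2
  + (4 * lambda - 2 * lambda * alpha - alpha + 3) * s1 + (1 - alpha) * s0 by ring.
have -> : (fun z => z * (2 - (S0 z + complex_deriv_sum a (1 + 2 * lambda) lambda 0 z)
            - complex_deriv_sum a (2 + 2 * lambda) (1 + 4 * lambda) lambda z)) =
  (fun z => lambda%:C * z ^+ 3 * derive1n 3 Phi z
                + (1 + 2 * lambda)%:C * z ^+ 2 * derive1n 2 Phi z
                + z * derive1n 1 Phi z).
  apply/funext => z; rewrite /derive1n/= (derive1_Phi _ _ aC) (derive2_Phi _ _ aC).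
  rewrite (derive3_Phi _ _ aC) /complex_deriv_sum !rmorphD !rmorph0 !rmorphM !rmorph_nat/=.
  by ring.
have -> : (fun z => z * (2 - (S0 z + complex_deriv_sum a (1 + 2 * lambda) lambda 0 z))) =
  (fun z => z * derive1n 1 Phi z + lambda%:C * z ^+ 2 * derive1n 2 Phi z).
  apply/funext => z; rewrite /derive1n/= (derive1_Phi _ _ aC) (derive2_Phi _ _ aC).
  rewrite /complex_deriv_sum !rmorphD !rmorph0 !rmorphM !rmorph_nat/=.
  by ring.
move=> crit; split=> [[[_ /crit//] _]|H]; split; last exact: Phi_classJ aC _ _.
split; last exact/crit.
apply: (Phi_classA _ _ aC) => //.
(* The surplus coefficients over [(1 - alpha) (s0 + s1)] are [lambda], [1 + lambda (5 - alpha)] and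
   [2 + lambda (4 - 2 alpha)], all nonnegative. *)
rewrite -(ler_pM2l (_ : 0 < 1 - alpha)) ?subr_gt0//.
have : 0 <= lambda * s3 by rewrite mulr_ge0.
have : 0 <= (1 + lambda * (5 - alpha)) * s2.
  by rewrite mulr_ge0// addr_ge0// mulr_ge0// subr_ge0; have := alpha1; lra.
have : 0 <= (2 + lambda * (4 - 2 * alpha)) * s1.
  by rewrite mulr_ge0// addr_ge0// mulr_ge0// subr_ge0; have := alpha1; lra.
by have := H; lra.
Qed.

End starlike_and_convex_classes.

(* The inequalities are between complex numbers: in the order of [R[i]],
   [x <= y] means that [x] and [y] have the same imaginary part and that the
   real part of [x] is at most that of [y]. Both sides are in fact real. *)
Theorem mainTheorem3 (R : realType) (nu alpha lambda : R)
  (hnu : - (1 / 2) < nu)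
  (halpha0 : 0 <= alpha) (halpha1 : alpha < 1)
  (hlambda0 : 0 <= lambda) (hlambda1 : lambda < 1) :
  (classT_star lambda alpha (bessel_struve_Phi nu) <->
     lambda%:C * derive1n 2 (bessel_struve nu) 1
     + (1 - lambda * alpha + 2 * lambda)%:C * derive1n 1 (bessel_struve nu) 1
     + (1 - alpha)%:C * bessel_struve nu 1
     <= (2 * (1 - alpha))%:C)
  /\
  (classL_star lambda alpha (bessel_struve_Phi nu) <->
     lambda%:C * derive1n 3 (bessel_struve nu) 1
     + (5 * lambda + 1 - lambda * alpha)%:C * derive1n 2 (bessel_struve nu) 1
     + (4 * lambda - 2 * lambda * alpha - alpha + 3)%:C
       * derive1n 1 (bessel_struve nu) 1
     + (1 - alpha)%:C * bessel_struve nu 1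
     <= (2 * (1 - alpha))%:C).
Proof.
have [C aC] := bessel_struve_coef_bounded nu hnu.
have a_init := bessel_struve_coef0 nu hnu.
have a_gt0 n := bessel_struve_coef_gt0 nu n hnu.
have aC1 := factorially_bounded_diffs _ _ aC.
have aC2 := factorially_bounded_diffs _ _ aC1.
have aC3 := factorially_bounded_diffs _ _ aC2.
(* Each derivative of the kernel at 1 is the embedding of a real series, so [lecR] reduces both
   inequalities to [R]. *)
have at1 (C' : R) b : factorially_bounded C' b ->
    complex_pseries b 1 = (real_pseries b 1)%:C.
  by move=> bC; rewrite -(complex_pseries_real _ _ bC).
have E0 : bessel_struve nu = complex_pseries (bessel_struve_coef nu) by [].
have EPhi : bessel_struve_Phi nu =
  (fun z => z * (2 - complex_pseries (bessel_struve_coef nu) z)) by [].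
rewrite EPhi E0 /derive1n/= !(derive1_complex_pseries _ _ aC).
rewrite !(derive1_complex_pseries _ _ aC1) (derive1_complex_pseries _ _ aC2).
rewrite (at1 _ _ aC) (at1 _ _ aC1) (at1 _ _ aC2) (at1 _ _ aC3).
rewrite -!(rmorphM (real_complex R)) -!(rmorphD (real_complex R)) !lecR.
split; first exact: (classT_star_Phi C).
exact: (classL_star_Phi C).
Qed.
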